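(* Let $N \geq 1$ be an integer, let $u:[0,1]\to\mathbb{R}$ be a function, and let $B_N[u] \in \mathbb{P}_N$ be its Bernstein reconstruction. Then the total variation of $B_N[u]$ is less than or equal to the total variation of $u$, i.e. $$TV(B_N[u]) \leq TV(u)$$ (in this sense the Bernstein procedure is total variation diminishing).
   Context: $\mathbb{P}_N$ denotes the space of real polynomials of degree at most $N$. The Bernstein reconstruction of degree $N$ of a function $u:[0,1]\to\mathbb{R}$ is the polynomial $$B_N[u](x) = \sum_{n=0}^N u\left(\frac{n}{N}\right) b_{n,N}(x), \qquad b_{n,N}(x) = \binom{N}{n} x^n (1-x)^{N-n}, \quad x \in [0,1].$$ The total variation of a function $v:[0,1]\to\mathbb{R}$ is $$TV(v) = \sup_{J \in \mathbb{N},\ 0=x_0 < \dots < x_J = 1} \ \sum_{j=0}^{J-1} \left| v(x_{j+1}) - v(x_j) \right| \in [0,\infty].$$ *)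

(* Defs.v *)
From mathcomp Require Import all_boot all_order all_algebra.
From mathcomp Require Import all_classical all_reals all_analysis.

Set Implicit Arguments.
Unset Strict Implicit.
Unset Printing Implicit Defensive.

Import Order.TTheory GRing.Theory Num.Theory.

Local Open Scope ring_scope.

Definition bernstein_basis (R : realType) (N n : nat) : {poly R} :=
  'C(N, n)%:R *: ('X^n * (1 - 'X) ^+ (N - n)).

(* Functions on [0, 1] are represented by total functions on R: [bernstein N u]
   with 0 < N and [total_variation 0 1 u] only evaluate u on [0, 1]. *)
Definition bernstein (R : realType) (N : nat) (u : R -> R) : {poly R} :=
  \sum_(n < N.+1) u (n%:R / N%:R) *: bernstein_basis R N n.

Lemma size_bernstein (R : realType) (N : nat) (u : R -> R) :
  (size (bernstein N u) <= N.+1)%N.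
Proof.
apply: (leq_trans (size_sum _ _ _)); apply/bigmax_leqP => n _.
do 2 apply: (leq_trans (size_scale_leq _ _)).
apply: (leq_trans (size_polyMleq _ _)); rewrite size_polyXn addSn /=.
have le_nN : (n <= N)%N by rewrite -ltnS.
have le2 : (size (1 - 'X : {poly R})).-1 = 1%N.
  by rewrite -opprB size_polyN size_XsubC.
apply: leq_trans (leq_add (leqnn n) (size_poly_exp_leq _ _)) _.
by rewrite le2 mul1n addnS subnKC.
Qed.

Lemma horner_bernstein (R : realType) (N : nat) (u : R -> R) (x : R) :
  (bernstein N u).[x] =
  \sum_(n < N.+1) u (n%:R / N%:R) * ('C(N, n)%:R * x ^+ n * (1 - x) ^+ (N - n)).
Proof.
rewrite horner_sum; apply: eq_bigr => n _.
by rewrite !hornerZ hornerM hornerXn horner_exp hornerD hornerN hornerC hornerX -(mulrA _%:R).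
Qed.

(* Main.v *)
Require Import Defs.
From mathcomp Require Import all_boot all_order all_algebra.
From mathcomp Require Import all_classical all_reals all_analysis.
From mathcomp Require Import ring lra.

(** Summation by parts turns the Bernstein reconstruction into
[[
  B_N[u](x) = u(0) + \sum_(i < N) (u((i+1)/N) - u(i/N)) * S_i(x),
]]
where [S_i(x)] is the probability that a binomial variable with [N] trials of
success probability [x] exceeds [i] ([horner_bernstein_by_parts]).  A likelier
success makes many successes likelier, so these tail probabilities are
nondecreasing in [x] ([binomial_tail_nondecreasing]); as probabilities they
stay in [[0, 1]] ([binomial_tail_itv]).

Hence along any partition of [[0, 1]] each [S_i] varies by at most 1, so the
variation of [B_N[u]] is at most [\sum_(i < N) |u((i+1)/N) - u(i/N)|]
([variation_sum_nondecreasing_le]).  This sum is the variation of [u] along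
the uniform grid, one of the values of which [TV(u)] is the supremum
([variation_uniform_grid]). *)

Import Order.TTheory GRing.Theory Num.Theory.

Local Open Scope ring_scope.

(** The probability of at least [k] successes in [N] independent trials of
success probability [x], by conditioning on the last trial.  In this form, a
convex combination of two tails with weights [1 - x] and [x], monotonicity in
[x] is amenable to induction on [N]. *)
Fixpoint binomial_tail {R : realType} (N k : nat) (x : R) : R :=
  match k, N with
  | 0, _ => 1
  | _.+1, 0 => 0
  | k'.+1, N'.+1 =>
      (1 - x) * binomial_tail N' k x + x * binomial_tail N' k' x
  end.

Lemma binomial_tail0 {R : realType} (N : nat) (x : R) : binomial_tail N 0 x = 1.
Proof. by case: N. Qed.

Lemma binomial_tail_gt {R : realType} (N k : nat) (x : R) :
  (N < k)%N -> binomial_tail N k x = 0.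
Proof.
elim: N k => [|N IHN] [|k] //= Nk.
by rewrite !IHN ?mulr0 ?addr0// ltnW.
Qed.

Lemma binomial_tail_itv {R : realType} (N k : nat) (x : R) :
  0 <= x <= 1 -> 0 <= binomial_tail N k x <= 1.
Proof.
move=> x01; elim: N k => [|N IHN] [|k] //=; rewrite ?lexx ?ler01//.
move: (IHN k.+1) (IHN k); nra.
Qed.

Lemma binomial_tail_succ_le {R : realType} (N k : nat) (x : R) :
  0 <= x <= 1 -> binomial_tail N k.+1 x <= binomial_tail N k x.
Proof.
move=> x01; elim: N k => [|N IHN] [|k] //=.
  have := binomial_tail_itv N 1 x x01.
  by rewrite binomial_tail0; nra.
by move: (IHN k.+1) (IHN k); nra.
Qed.

(** Moving weight from [1 - x] to [x] favours the tail at [k - 1], which is the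
larger of the two. *)
Lemma binomial_tail_nondecreasing {R : realType} (N k : nat) :
  {in `[0, 1] &, nondecreasing_fun (binomial_tail N k : R -> R)}.
Proof.
move=> x y; rewrite !in_itv/= => x01 y01 xy.
elim: N k => [|N IHN] [|k] //=.
have := binomial_tail_succ_le N k x x01.
by move: (IHN k.+1) (IHN k); nra.
Qed.

(** The left-hand side is the probability of exactly [k] successes: at least
[k], but not at least [k + 1]. *)
Lemma binomial_tail_sub {R : realType} (N k : nat) (x : R) :
  'C(N, k)%:R * x ^+ k * (1 - x) ^+ (N - k) =
  binomial_tail N k x - binomial_tail N k.+1 x.
Proof.
elim: N k => [|N IHN] [|k] /=.
- by rewrite bin0 !expr0 !mulr1 subr0.
- by rewrite bin0n !mul0r subrr.
- have := IHN 0%N; rewrite !bin0 !subn0 binomial_tail0 exprS => IH0.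
  by rewrite mulrCA IH0; ring.
have -> : (1 - x) * binomial_tail N k.+1 x + x * binomial_tail N k x -
    ((1 - x) * binomial_tail N k.+2 x + x * binomial_tail N k.+1 x) =
  (1 - x) * (binomial_tail N k.+1 x - binomial_tail N k.+2 x) +
  x * (binomial_tail N k x - binomial_tail N k.+1 x) by ring.
rewrite -!IHN binS natrD subSS.
(* The truncated exponent [N - k.+1] is off when [N <= k], but then the
   binomial coefficient in front vanishes. *)
have [kN|Nk] := ltnP k N.
  by rewrite -(subnSK kN) !exprS; ring.
by rewrite bin_small ?ltnS// exprS; ring.
Qed.

Lemma sum_by_parts {R : pzRingType} (n : nat) (v t : nat -> R) :
  \sum_(i < n.+1) v i * (t i - t i.+1) =
  v 0%N * t 0%N + \sum_(i < n) (v i.+1 - v i) * t i.+1 - v n * t n.+1.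
Proof.
elim: n => [|n IHn].
  by rewrite big_ord1 big_ord0 addr0 mulrBr.
rewrite big_ord_recr IHn [in RHS]big_ord_recr /= mulrBr mulrBl !addrA.
by congr (_ - _); rewrite addrAC -!addrA; congr (_ + (_ + _)); rewrite addrC.
Qed.

Lemma horner_bernstein_by_parts {R : realType} (N : nat) (u : R -> R) (x : R) :
  (bernstein N u).[x] =
  u 0 + \sum_(i < N)
    (u (i.+1%:R / N%:R) - u (i%:R / N%:R)) * binomial_tail N i.+1 x.
Proof.
rewrite horner_bernstein.
under eq_bigr do rewrite binomial_tail_sub.
rewrite (sum_by_parts N (fun i => u (i%:R / N%:R))
                        (fun i => binomial_tail N i x)).
by rewrite binomial_tail0 binomial_tail_gt// mul0r mulr1 mulr0 subr0.
Qed.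

(** The triangle inequality on each step of the partition bounds the variation
by that of each [g i] weighted by [`|d i|], and the increments of a
nondecreasing [g i] are nonnegative, so they telescope. *)
Lemma variation_sum_nondecreasing_le {R : realType} (a b c : R) (m : nat)
    (d : 'I_m -> R) (g : 'I_m -> R -> R) (s : seq R) :
  (forall i, {in `[a, b] &, nondecreasing_fun (g i)}) -> itv_partition a b s ->
  variation a b (fun x => c + \sum_(i < m) d i * g i x) s <=
  \sum_(i < m) `|d i| * (g i b - g i a).
Proof.
move=> g_nd abs.
under [leRHS]eq_bigr do rewrite -(nondecreasing_variation (g_nd _) abs) mulr_sumr.
rewrite exchange_big /=; apply: ler_sum => n _.
rewrite opprD addrACA subrr add0r -sumrB.
apply: (le_trans (ler_norm_sum _ _ _)); apply: ler_sum => i _.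
by rewrite -mulrBr normrM.
Qed.

Definition uniform_grid {R : realType} (N : nat) : seq R :=
  [seq n.+1%:R / N%:R | n <- iota 0 N].

Lemma nth_uniform_grid {R : realType} (N n : nat) (x : R) :
  (n <= N)%N -> nth x (0 :: uniform_grid N) n = n%:R / N%:R.
Proof.
case: n => [|n] nN /=; first by rewrite mul0r.
by rewrite (nth_map 0%N) ?size_iota// nth_iota.
Qed.

Lemma uniform_grid_partition {R : realType} (N : nat) :
  (0 < N)%N -> itv_partition (0 : R) 1 (uniform_grid N).
Proof.
move=> N0; have sz : size (@uniform_grid R N) = N by rewrite size_map size_iota.
split.
  apply/(pathP 0) => i; rewrite sz => iN.
  rewrite -[nth _ (uniform_grid N) i]/(nth 0 (0 :: uniform_grid N) i.+1).
  rewrite (nth_uniform_grid N i 0 (ltnW iN)) (nth_uniform_grid N i.+1 0 iN).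
  rewrite ltr_pM2r.
    by rewrite ltr_nat.
  by rewrite invr_gt0 ltr0n.
by rewrite (last_nth 0) sz nth_uniform_grid// divff// pnatr_eq0 -lt0n.
Qed.

Lemma variation_uniform_grid {R : realType} (N : nat) (u : R -> R) :
  variation 0 1 u (uniform_grid N) =
  \sum_(i < N) `|u (i.+1%:R / N%:R) - u (i%:R / N%:R)|.
Proof.
rewrite /variation size_map size_iota big_mkord; apply: eq_bigr => i _.
rewrite /comp (nth_uniform_grid N i.+1 1 (ltn_ord i)).
by rewrite (nth_uniform_grid N i 1 (ltnW (ltn_ord i))).
Qed.

Theorem theorem8 (R : realType) (N : nat) (u : R -> R) :
  (1 <= N)%N ->
  (total_variation 0 1 (fun x : R => (bernstein N u).[x])
    <= total_variation 0 1 u)%E.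
Proof.
move=> N_gt0; apply: ge_ereal_sup => _ /= [_ [s s01 <-] <-].
apply: (@le_trans _ _ (variation 0 1 u (uniform_grid N))%:E); last first.
  apply: ereal_sup_ubound => /=; exists (variation 0 1 u (uniform_grid N)) => //.
  exact/variations_variation/uniform_grid_partition.
rewrite lee_fin variation_uniform_grid.
under [X in variation _ _ X _]funext do rewrite horner_bernstein_by_parts.
apply: le_trans (variation_sum_nondecreasing_le _ _ _ _ _ _ _ _ s01) _.
  by move=> i; exact: binomial_tail_nondecreasing.
apply: ler_sum => i _; apply: ler_piMr => //.
have /andP[_ le1] : 0 <= binomial_tail N i.+1 (1 : R) <= 1.
  by apply: binomial_tail_itv; rewrite ler01 lexx.
have /andP[ge0 _] : 0 <= binomial_tail N i.+1 (0 : R) <= 1.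
  by apply: binomial_tail_itv; rewrite ler01 lexx.
by rewrite lerBlDr (le_trans le1)// lerDl.
Qed.
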